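(* Let $R=k[x_1,\dots,x_d]$ be a polynomial ring in $x_1,\dots,x_d$ over a perfect field $k$ of characteristic $p>0$ and let $f\in R$ be any element. Then the descending chain of ideals $$I_1(f^{p-1})\supseteq I_2(f^{p^2-1})\supseteq I_3(f^{p^3-1})\supseteq\cdots$$ stabilizes.
   Context: For a ring $R$ of characteristic $p$, $R^{p^s}$ denotes the subring of $p^s$-th powers of elements of $R$. Here $R$ is a free $R^{p^s}$-module of finite rank for every $s\ge1$. For $g\in R$ and $s\ge 1$, the ideal $I_s(g)$ is defined as follows: let $\{c_1^{p^s},c_2^{p^s},\dots\}\subset R^{p^s}$ be the coordinates of $g$ with respect to some $R^{p^s}$-basis of $R$; then $I_s(g)$ is the ideal of $R$ generated by $\{c_1,c_2,\dots\}$ (it is independent of the basis). *)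

(* Defs.v *)
From HB Require Import structures.
From mathcomp Require Import all_boot all_order all_algebra.
From mathcomp Require Export mpoly.

Set Implicit Arguments.
Unset Strict Implicit.
Unset Printing Implicit Defensive.

Import GRing.Theory.
Local Open Scope ring_scope.

Definition perfect_pchar (k : fieldType) (p : nat) : Prop :=
  p \in [pchar k] /\ forall x : k, exists y : k, x = y ^+ p.

Section FrobeniusIdeals.

Variables (R : comNzRingType) (p : nat).

(* Membership in R^{p^s}; this is a subring when R has characteristic p. *)
Definition frob_powers (s : nat) (a : R) : Prop :=
  exists c : R, a = c ^+ (p ^ s).

Definition frob_basis (s n : nat) (b : 'I_n -> R) : Prop :=
  (forall g : R, exists2 a : 'I_n -> R,
      forall i, frob_powers s (a i) & g = \sum_(i < n) a i * b i) /\
  (forall a : 'I_n -> R, (forall i, frob_powers s (a i)) ->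
      \sum_(i < n) a i * b i = 0 -> forall i, a i = 0).

Definition ideal_gen (n : nat) (c : 'I_n -> R) (h : R) : Prop :=
  exists r : 'I_n -> R, h = \sum_(i < n) r i * c i.

(* Membership of h in I_s(g).  The ideal generated by the c_i does not depend
   on the basis when R is a reduced ring of characteristic p that is free of
   finite rank over R^{p^s}, so the basis is quantified existentially. *)
Definition frob_ideal (s : nat) (g h : R) : Prop :=
  exists (n : nat) (b c : 'I_n -> R),
    [/\ frob_basis s b,
        g = \sum_(i < n) c i ^+ (p ^ s) * b i
      & ideal_gen c h].

End FrobeniusIdeals.

(* Main.v *)
Require Import Defs.
From mathcomp Require Import all_boot all_order all_algebra.
From mathcomp Require Import mpoly.
From Stdlib Require Import Classical.

Set Implicit Arguments.
Unset Strict Implicit.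
Unset Printing Implicit Defensive.

Import GRing.Theory.
Local Open Scope ring_scope.

(** Write q = p^s and let D be the total degree of f.

    The one fact about the ideals I_s that carries everything is
    [frob_ideal_sub]: if g is any combination of q-th powers c_i^q, with
    arbitrary coefficients y_i, then I_s(g) lies in the ideal (c_i).  Indeed,
    expanding the y_i in a basis shows that each coordinate of g is a sum
    of terms (c_i e_ij)^q, hence the q-th power of an element of (c_i), and
    q-th roots are unique in a domain of characteristic p.  Independence of
    the basis is a special case.

    The chain descends because f^(pq-1) = (f^(q-1))^p f^(p-1): raising an
    expansion of f^(q-1) in the c_i^q to the p-th power expresses f^(pq-1) by
    the c_i^(pq), with the same c_i ([frob_ideal_expM_sub]).

    It stabilizes because of a degree bound that is uniform in s.  As k is
    perfect, the monomials with exponents below q form a basis of R over R^q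
    ([frob_basis_res]), and each coordinate c^q of f^(q-1) in it satisfies
    q deg c <= (q-1) D, so that deg c <= D ([frob_coords_expB1]).  Hence every
    I_s is generated by its elements of degree at most D.  These form a
    descending chain of subspaces of a finite-dimensional k-vector space,
    which is eventually constant ([subspace_chain_stable]); so are the ideals
    that they generate. *)

(** * Ideals generated by finite families *)

Lemma ideal_gen_mem (R : comNzRingType) (n : nat) (c : 'I_n -> R) (i : 'I_n) :
  ideal_gen c (c i).
Proof.
exists (fun j => (j == i)%:R).
by rewrite (bigD1 i) //= eqxx mul1r big1 ?addr0 // => j /negbTE ->; rewrite mul0r.
Qed.

Lemma ideal_gen_trans (R : comNzRingType) (m n : nat) (c : 'I_m -> R)
    (c' : 'I_n -> R) (h : R) :
  (forall i, ideal_gen c' (c i)) -> ideal_gen c h -> ideal_gen c' h.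
Proof.
move=> /fin_all_exists[e ce] [r ->]; exists (fun j => \sum_i r i * e i j).
under [RHS]eq_bigr do rewrite mulr_suml.
rewrite exchange_big; apply: eq_bigr => i _ /=.
by rewrite ce mulr_sumr; apply: eq_bigr => j _; rewrite mulrA.
Qed.

Lemma ideal_genZD (R : comNzRingType) (n : nat) (c : 'I_n -> R) (u v h : R) :
  ideal_gen c u -> ideal_gen c v -> ideal_gen c (h * u + v).
Proof.
move=> [r ->] [t ->]; exists (fun i => h * r i + t i).
rewrite mulr_sumr -big_split; apply: eq_bigr => i _ /=.
by rewrite mulrDl mulrA.
Qed.

Lemma ideal_gen0 (R : comNzRingType) (n : nat) (c : 'I_n -> R) : ideal_gen c 0.
Proof. by exists (fun=> 0); rewrite big1 // => i _; rewrite mul0r. Qed.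

(** * The ideals I_s in a domain of characteristic p *)

Section Frobenius.

Variables (R : idomainType) (p : nat).
Hypothesis pcharRp : p \in [pchar R].

Lemma pnat_pchar_exp (s : nat) : [pchar R].-nat (p ^ s)%N.
Proof.
by rewrite pnatX; apply/orP; left; rewrite pnatE ?(pcharf_prime pcharRp).
Qed.

Lemma pchar_exp_gt0 (s : nat) : (0 < p ^ s)%N.
Proof. by rewrite expn_gt0 prime_gt0 // (pcharf_prime pcharRp). Qed.

Lemma expr_sum_pchar (s : nat) (I : Type) (r : seq I) (P : pred I) (F : I -> R) :
  (\sum_(i <- r | P i) F i) ^+ (p ^ s) = \sum_(i <- r | P i) F i ^+ (p ^ s).
Proof.
apply: (big_morph (fun x => x ^+ (p ^ s))) => [x y|].
  exact/exprDn_pchar/pnat_pchar_exp.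
by rewrite expr0n eqn0Ngt pchar_exp_gt0.
Qed.

(** Freeness of b together with the injectivity of Frobenius forces
    a_j = sum_i e_ij c_i, where the e_ij^q are the coordinates of y_i. *)
Lemma frob_coords_ideal_gen (s m n : nat) (b : 'I_n -> R) (a : 'I_n -> R)
    (c y : 'I_m -> R) :
  frob_basis p s b ->
  \sum_(j < n) a j ^+ (p ^ s) * b j = \sum_(i < m) c i ^+ (p ^ s) * y i ->
  forall j, ideal_gen c (a j).
Proof.
move=> [span_b free_b] eq_g.
have [e ye] : exists e : 'I_m -> 'I_n -> R,
    forall i, y i = \sum_j e i j ^+ (p ^ s) * b j.
  apply: (@fin_all_exists _ _ (fun i w => y i = \sum_j w j ^+ (p ^ s) * b j)) => i.
  have [u /fin_all_exists[w uw] ->] := span_b (y i).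
  by exists w; apply: eq_bigr => j _; rewrite uw.
pose a' j := \sum_i e i j * c i.
have eq_g' : \sum_j (a j - a' j) ^+ (p ^ s) * b j = 0.
  transitivity (\sum_j a j ^+ (p ^ s) * b j - \sum_j a' j ^+ (p ^ s) * b j).
    rewrite -sumrB; apply: eq_bigr => j _.
    rewrite exprDn_pchar ?exprNn_pchar ?pnat_pchar_exp //.
    by rewrite mulrDl mulNr.
  apply/eqP; rewrite subr_eq0 eq_g; apply/eqP.
  under [LHS]eq_bigr do rewrite ye mulr_sumr.
  rewrite exchange_big; apply: eq_bigr => j _ /=.
  rewrite expr_sum_pchar mulr_suml; apply: eq_bigr => i _.
  by rewrite exprMn mulrA [_ * c i ^+ _]mulrC.
move=> j; exists (fun i => e i j); apply/eqP; rewrite -subr_eq0.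
have /eqP := free_b _ (fun j => ex_intro _ (a j - a' j) erefl) eq_g' j.
by rewrite expf_eq0 => /andP[].
Qed.

Lemma frob_ideal_sub (s m : nat) (c y : 'I_m -> R) (g h : R) :
  g = \sum_(i < m) c i ^+ (p ^ s) * y i ->
  frob_ideal p s g h -> ideal_gen c h.
Proof.
move=> -> [n [b [a [basis_b eq_g]]]]; apply: ideal_gen_trans.
exact: frob_coords_ideal_gen basis_b (esym eq_g).
Qed.

Lemma frob_idealZD (s : nat) (g u v h : R) :
  frob_ideal p s g u -> frob_ideal p s g v -> frob_ideal p s g (h * u + v).
Proof.
move=> [n [b [c [basis_b eq_g cu]]]] gv; exists n, b, c; split=> //.
by apply: ideal_genZD => //; apply: frob_ideal_sub eq_g gv.
Qed.

(** The element u is a witness that R has a basis over its q-th powers: an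
    empty family c would not provide one. *)
Lemma frob_ideal_trans (s m : nat) (g h u : R) (c : 'I_m -> R) :
  frob_ideal p s g u ->
  (forall i, frob_ideal p s g (c i)) -> ideal_gen c h -> frob_ideal p s g h.
Proof.
move=> [n [b [a [basis_b eq_g _]]]] gc ch; exists n, b, a; split=> //.
by apply: ideal_gen_trans ch => i; apply: frob_ideal_sub eq_g (gc i).
Qed.

(** From f^(q-1) = sum c_i^q b_i one gets
    f^(pq-1) = sum c_i^(pq) (b_i^p f^(p-1)), where b_i^p f^(p-1) is no longer a
    basis element: this is why [frob_ideal_sub] allows arbitrary coefficients. *)
Lemma frob_ideal_expM_sub (s n : nat) (b : 'I_n -> R) (f h : R) :
  frob_basis p s b ->
  frob_ideal p s.+1 (f ^+ (p ^ s.+1 - 1)) h ->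
  frob_ideal p s (f ^+ (p ^ s - 1)) h.
Proof.
move=> [span_b free_b] fh.
have [a /fin_all_exists[c ac] eq_f] := span_b (f ^+ (p ^ s - 1)).
exists n, b, c; split=> //; first by rewrite eq_f; apply: eq_bigr => i _; rewrite ac.
have p_gt0 : (0 < p)%N by rewrite prime_gt0 // (pcharf_prime pcharRp).
have exp_f : (p ^ s.+1 - 1 = (p ^ s - 1) * p + (p - 1))%N.
  by rewrite mulnBl mul1n -expnSr addnBA // subnK // -[X in (X <= _)%N](expn1) leq_pexp2l.
apply: (@frob_ideal_sub s.+1 _ c (fun i => b i ^+ p * f ^+ (p - 1))) fh.
rewrite exp_f exprD exprM eq_f -[X in _ ^+ X](expn1 p) expr_sum_pchar mulr_suml.
apply: eq_bigr => i _.
by rewrite ac expn1 exprMn -exprM -expnSr mulrA.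
Qed.

End Frobenius.

(** * Euclidean division of monomials by q *)

Section MonomialBasis.

Variables (d q : nat).
Hypothesis q_gt0 : (0 < q)%N.
Implicit Types (m : 'X_{1..d}) (r : {ffun 'I_d -> 'I_q}).

Definition mnm_div m : 'X_{1..d} := [multinom (m i %/ q)%N | i < d].
Definition mnm_mod m : {ffun 'I_d -> 'I_q} :=
  [ffun i => Ordinal (ltn_pmod (m i) q_gt0)].
Definition mnm_res r : 'X_{1..d} := [multinom (r i : nat) | i < d].

Lemma mnm_divn_eq m : m = (mnm_div m *+ q + mnm_res (mnm_mod m))%MM.
Proof.
by apply/mnmP => i; rewrite mnmDE mulmnE !mnmE ffunE /= -divn_eq.
Qed.

Lemma mnm_divMD m r : mnm_div (m *+ q + mnm_res r)%MM = m.
Proof.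
by apply/mnmP => i; rewrite mnmE mnmDE mulmnE mnmE divnMDl // divn_small ?addn0.
Qed.

Lemma mnm_modMD m r : mnm_mod (m *+ q + mnm_res r)%MM = r.
Proof.
apply/ffunP => i; apply/val_inj.
by rewrite ffunE /= mnmDE mulmnE mnmE modnMDl modn_small.
Qed.

End MonomialBasis.

(** * The monomial basis over the q-th powers, and the degree bound *)

Section PolynomialRing.

Variables (k : fieldType) (p d : nat).
Hypothesis perfect_k : perfect_pchar k p.

Local Notation R := {mpoly k[d]}.

Lemma pchar_perfect_mpoly : p \in [pchar R].
Proof. by rewrite pchar_lalg; case: perfect_k. Qed.

Lemma perfect_root (s : nat) : exists root : k -> k, cancel root (fun x => x ^+ (p ^ s)).
Proof.
have root1 x : exists y : k, y ^+ p == x.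
  by have [y ->] := perfect_k.2 x; exists y.
elim: s => [|s [root rootK]]; first by exists id => x; rewrite expr1.
exists (fun x => xchoose (root1 (root x))) => x.
by rewrite expnS exprM (eqP (xchooseP (root1 (root x)))) rootK.
Qed.

Local Notation pR := pchar_perfect_mpoly.

Lemma mpoly_frobE (s : nat) (c : R) :
  c ^+ (p ^ s) = \sum_(m <- msupp c) c@_m ^+ (p ^ s) *: 'X_[m *+ p ^ s].
Proof.
rewrite {1}(mpolyE c) (expr_sum_pchar pR); apply: eq_bigr => m _.
by rewrite exprZn mpolyXn.
Qed.

(** The exponents m q + r of c^q X^r determine both m and the residue r, so
    distinct residues contribute to disjoint sets of monomials: this gives the
    freeness of the monomial basis. *)
Lemma mcoeff_frob_res (s : nat) (c : R) (r r' : {ffun 'I_d -> 'I_(p ^ s)}) m :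
  (c ^+ (p ^ s) * 'X_[mnm_res r])@_(m *+ (p ^ s) + mnm_res r')%MM
  = (r == r')%:R * c@_m ^+ (p ^ s).
Proof.
have q_gt0 := pchar_exp_gt0 pR s.
rewrite mpoly_frobE mulr_suml raddf_sum /=.
under eq_bigr => m' _.
  rewrite -scalerAl -mpolyXD mcoeffZ mcoeffX.
  have -> : ((m' *+ p ^ s + mnm_res r)%MM == (m *+ p ^ s + mnm_res r')%MM)
            = (r == r') && (m' == m).
    apply/eqP/andP => [eq_m|[/eqP-> /eqP->] //].
    move: (congr1 (mnm_mod q_gt0) eq_m) (congr1 (mnm_div (p ^ s)) eq_m).
    by rewrite !mnm_modMD !(mnm_divMD q_gt0) => -> ->.
  over.
have [m_c|m_c] := boolP (m \in msupp c).
  rewrite (bigD1_seq m) ?msupp_uniq //= eqxx andbT mulrC big1 ?addr0 //.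
  by move=> m' /negbTE->; rewrite andbF mulr0.
rewrite (memN_msupp_eq0 m_c) expr0n eqn0Ngt q_gt0 mulr0.
rewrite big1_seq // => m' /=.
by case: (m' =P m) => [->|_ _]; [rewrite (negbTE m_c) | rewrite andbF mulr0].
Qed.

(** Grouping the monomials of f by the residue of their exponents modulo q and
    taking q-th roots of the coefficients; dividing the exponents by q divides
    the degree by at least q. *)
Lemma frob_residue_expansion (s : nat) (f : R) (D : nat) :
  {in msupp f, forall m, mdeg m <= D * p ^ s}%N ->
  exists2 c : {ffun 'I_d -> 'I_(p ^ s)} -> R,
    f = \sum_r c r ^+ (p ^ s) * 'X_[mnm_res r] &
    forall r, (msize (c r) <= D.+1)%N.
Proof.
move=> degf; have q_gt0 := pchar_exp_gt0 pR s; have [root rootK] := perfect_root s.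
exists (fun r => \sum_(m <- msupp f | mnm_mod q_gt0 m == r)
                   root f@_m *: 'X_[mnm_div (p ^ s) m]) => [|r].
  rewrite {1}(mpolyE f) (partition_big (mnm_mod q_gt0) predT) //=.
  apply: eq_bigr => r _; rewrite (expr_sum_pchar pR) mulr_suml.
  apply: eq_bigr => m /eqP <-.
  by rewrite exprZn rootK mpolyXn -scalerAl -mpolyXD -mnm_divn_eq.
apply: (leq_trans (msize_sum _ _ _)); rewrite big_seq_cond.
apply/bigmax_leqP_seq => m _ /andP[mf _].
apply: leq_trans (msizeZ_le _ _) _; rewrite msizeX ltnS -(leq_pmul2r q_gt0).
apply: leq_trans (degf m mf).
by rewrite {2}(mnm_divn_eq q_gt0 m) mdegD mdegMn leq_addr.
Qed.

(** The finite type of residues is enumerated, bases being indexed by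
    ordinals. *)
Definition res_basis (s : nat) (i : 'I_#|{ffun 'I_d -> 'I_(p ^ s)}|) : R :=
  'X_[mnm_res (enum_val i)].

Lemma sum_res_basis (s : nat) (a : {ffun 'I_d -> 'I_(p ^ s)} -> R) :
  \sum_r a r * 'X_[mnm_res r] = \sum_i a (enum_val i) * res_basis i.
Proof. by rewrite (reindex _ (onW_bij _ (@enum_val_bij _))). Qed.

Lemma frob_basis_res (s : nat) : frob_basis p s (@res_basis s).
Proof.
have q_gt0 := pchar_exp_gt0 pR s; split=> [g|a pow_a eq0].
  have [m mg|c -> _] := @frob_residue_expansion s g (msize g).
    by rewrite -[X in (X <= _)%N]muln1 leq_mul // ltnW // msize_mdeg_lt.
  exists (fun i => c (enum_val i) ^+ (p ^ s)); first by move=> i; exists (c (enum_val i)).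
  exact: sum_res_basis (fun r => c r ^+ (p ^ s)).
have [c ac] := fin_all_exists pow_a; move=> i.
rewrite ac; suff -> : c i = 0 by rewrite expr0n eqn0Ngt q_gt0.
apply/mpolyP => m; rewrite mcoeff0; apply/eqP.
have: (\sum_j a j * res_basis j)@_(m *+ p ^ s + mnm_res (enum_val i))%MM = 0.
  by rewrite eq0 mcoeff0.
rewrite raddf_sum (bigD1 i) //= big1 => [|j ne_ji].
  by rewrite addr0 ac mcoeff_frob_res eqxx mul1r => /eqP; rewrite expf_eq0 => /andP[].
by rewrite ac mcoeff_frob_res (inj_eq enum_val_inj) (negbTE ne_ji) mul0r.
Qed.

Lemma mdeg_msupp_exp (f : R) (n : nat) m :
  m \in msupp (f ^+ n) -> (mdeg m <= (msize f).-1 * n)%N.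
Proof.
elim: n m => [|n IHn] m.
  by rewrite expr0 msupp1 inE => /eqP->; rewrite mdeg0.
rewrite exprS => /msuppM_le /allpairsP[[m1 m2] /= [m1f m2f ->]].
rewrite mdegD mulnS leq_add ?IHn //.
by have := msize_mdeg_lt m1f; case: (msize f).
Qed.

(** The bound (q-1) deg f <= q deg f keeps the degree of the coordinates
    bounded independently of s.  Since [msize] is one more than the degree,
    (msize f).-1 is deg f, or 0 when f = 0. *)
Lemma frob_coords_expB1 (s : nat) (f : R) :
  exists n (b c : 'I_n -> R),
    [/\ frob_basis p s b, f ^+ (p ^ s - 1) = \sum_(i < n) c i ^+ (p ^ s) * b i
      & forall i, (msize (c i) <= (msize f).-1.+1)%N].
Proof.
have [|c eq_f c_le] := @frob_residue_expansion s (f ^+ (p ^ s - 1)) (msize f).-1.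
  by move=> m /mdeg_msupp_exp /leq_trans; apply; rewrite leq_mul // leq_subr.
exists _, (@res_basis s), (c \o enum_val); split=> [||i /=]; last exact: c_le.
  exact: frob_basis_res.
by rewrite eq_f (sum_res_basis (fun r => c r ^+ (p ^ s))).
Qed.

End PolynomialRing.

(** * Stabilization *)

(** Subspaces are predicates here, because no matrix spanning the elements of
    bounded degree of I_s is at hand.  The induction is on a strict bound r for
    the ranks of the matrices whose row space lies in P s: if the chain is not constant
    from s on, a vector v is lost at some later t, and adding v to a matrix
    with row space in P t increases its rank within P s, so the ranks are
    bounded by r - 1 from t on. *)
Lemma subspace_chain_stable (k : fieldType) (n : nat)
    (P : nat -> 'rV[k]_n -> Prop) :
  (forall s, P s 0) ->
  (forall s a u v, P s u -> P s v -> P s (a *: u + v)) ->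
  (forall s v, P s.+1 v -> P s v) ->
  exists N, forall s v, (N <= s)%N -> P N v -> P s v.
Proof.
move=> P0 PZD Pdec.
have Ple s t v : (s <= t)%N -> P t v -> P s v.
  by move=> /subnK <-; elim: (t - s)%N => // j IH /Pdec.
suff stab r s : (forall A : 'M_n, (forall v, (v <= A)%MS -> P s v) -> (\rank A < r)%N) ->
    exists N, forall s v, (N <= s)%N -> P N v -> P s v.
  by apply: (stab n.+1 0%N) => A _; rewrite ltnS rank_leq_row.
elim: r s => [|r IHr] s rankP.
  suff: (\rank (0%R : 'M[k]_n) < 0)%N by [].
  by apply: rankP => v; rewrite submx0 => /eqP->.
have [const|/not_all_ex_not[t /not_all_ex_not[v nconst]]] :=
  classic (forall t v, (s <= t)%N -> P s v -> P t v); first by exists s.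
have [s_t nconst'] := imply_to_and _ _ nconst.
have [Psv nPtv] := imply_to_and _ _ nconst'.
apply: (IHr t) => A AP; rewrite -ltnS.
apply: leq_trans (rankP (A + v)%MS _); last first.
  move=> u /sub_addsmxP[[w1 w2] /= ->].
  rewrite addrC (mx11_scalar w2) mul_scalar_mx; apply: PZD => //.
  by apply: (Ple _ t) => //; apply/AP/submxMl.
rewrite ltnS rank_ltmx // ltmxE addsmxSl /=.
apply/negP => sub_A; apply: nPtv; apply: AP.
exact: submx_trans (addsmxSr _ _) sub_A.
Qed.

Theorem theorem3p7 (k : fieldType) (p : nat) (hk : perfect_pchar k p)
    (d : nat) (f : {mpoly k[d]}) :
  (forall (s : nat) (h : {mpoly k[d]}), (1 <= s)%N ->
     frob_ideal p s.+1 (f ^+ (p ^ s.+1 - 1)) h ->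
     frob_ideal p s (f ^+ (p ^ s - 1)) h) /\
  (exists2 N : nat, (1 <= N)%N &
     forall (s : nat) (h : {mpoly k[d]}), (N <= s)%N ->
       (frob_ideal p s (f ^+ (p ^ s - 1)) h <->
        frob_ideal p N (f ^+ (p ^ N - 1)) h)).
Proof.
have pR := pchar_perfect_mpoly d hk.
pose I s h := frob_ideal p s (f ^+ (p ^ s - 1)) h.
have Idec s h : I s.+1 h -> I s h.
  exact: frob_ideal_expM_sub (frob_basis_res d hk s).
split=> [s h _|]; first exact: Idec.
have Ile s t h : (s <= t)%N -> I t h -> I s h.
  by move=> /subnK <-; elim: (t - s)%N => // j IH /Idec.
have I0 s : I s 0.
  have [n [b [c [basis_b eq_f _]]]] := frob_coords_expB1 hk s f.
  by exists n, b, c; split=> //; apply: ideal_gen0.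
have I_ZD s u v h : I s u -> I s v -> I s (h * u + v) by exact: frob_idealZD.
(* Coordinates on the polynomials of degree at most deg f: the monomials of
   degree < (deg f).+1. *)
pose B := 'X_{1..d < (msize f).-1.+1}.
pose poly_of (v : 'rV[k]_#|{: B}|) : {mpoly k[d]} :=
  \sum_i v 0 i *: 'X_[(enum_val i : B)].
(* The index is shifted because the chain starts at s = 1. *)
have [s|s a u v Iu Iv|s v Iv|N stabN] :=
    @subspace_chain_stable k _ (fun s v => I s.+1 (poly_of v)).
- suff -> : poly_of 0 = 0 by exact: I0.
  by rewrite /poly_of big1 // => i _; rewrite mxE scale0r.
- have -> : poly_of (a *: u + v) = a%:MP * poly_of u + poly_of v.
    rewrite mul_mpolyC scaler_sumr -big_split; apply: eq_bigr => i _ /=.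
    by rewrite !mxE scalerDl scalerA.
  exact: I_ZD.
- exact: Idec.
exists N.+1 => // s h lt_Ns; split; first exact: Ile.
have [n [b [c [basis_b eq_f c_le]]]] := frob_coords_expB1 hk N.+1 f.
(* I_(N+1) is generated by the c i of degree at most deg f, and each of them
   stays in the later ideals. *)
move=> /(frob_ideal_sub pR eq_f) ch.
apply: (frob_ideal_trans pR (I0 s) _ ch) => i.
have ci : c i = poly_of (\row_j (c i)@_(enum_val j : B)).
  rewrite {1}(mpolywE (c_le i)) (reindex _ (onW_bij _ (@enum_val_bij _))).
  by apply: eq_bigr => j _; rewrite mxE.
case: s lt_Ns => // s lt_Ns.
rewrite ci; apply: (stabN s) => //; rewrite -ci /I.
by exists n, b, c; split=> //; apply: ideal_gen_mem.
Qed.
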